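(* Let $G$ be an $\omega$-hypercentral group and let $\phi$ be an automorphism of $G$. Then for every normal subgroup $H$ of $G$ with $\phi(H)=H$ one has $$h(\phi)=h(\phi\upharpoonright_H)+h(\bar\phi_{G/H}),$$ where $\phi\upharpoonright_H$ is the restriction of $\phi$ to $H$ and $\bar\phi_{G/H}$ is the map induced by $\phi$ on $G/H$. Moreover, if $G$ is also torsion, then either $h(\phi)=\infty$ or $h(\phi)=\log(\alpha)$ for some positive integer $\alpha$.
   Context: Algebraic entropy: for a group $G$, an endomorphism $\phi$ of $G$ and a non-empty finite subset $F\subseteq G$, put $T_n(\phi,F)=F\,\phi(F)\cdots\phi^{n-1}(F)$ (product of subsets) for each integer $n\ge 1$, and $H(\phi,F)=\limsup_{n\to\infty}\frac1n\log|T_n(\phi,F)|$ (in fact a limit). The algebraic entropy of $\phi$ is $h(\phi)=\sup_F H(\phi,F)\in[0,\infty]$, where $F$ ranges over all non-empty finite subsets of $G$. Sums are taken in $[0,\infty]$ with the usual convention $x+\infty=\infty$. Upper central series: $Z_0(G)=\{1\}$ and $Z_{n+1}(G)/Z_n(G)=Z(G/Z_n(G))$ for $n\ge 0$, where $Z(\cdot)$ denotes the center. A group $G$ is $\omega$-hypercentral if $G=\bigcup_{n\in\mathbb N}Z_n(G)$. A group is torsion if each of its elements has finite order. *)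

(* Defs.v *)
From HB Require Import structures.
From mathcomp Require Import all_boot generic_quotient all_order all_algebra finmap.
From mathcomp Require Import all_classical all_reals all_analysis.

Set Implicit Arguments.
Unset Strict Implicit.
Unset Printing Implicit Defensive.

Import Order.TTheory GRing.Theory Num.Theory.
Local Open Scope classical_set_scope.
Local Open Scope group_scope.

HB.mixin Record isConjClosed (G : groupType) (S : {pred G}) := {
  gpred_conj : forall x y : G, x \in S -> x ^ y \in S
}.

#[short(type="normalClosed")]
HB.structure Definition NormalClosed (G : groupType) :=
  {S of GroupClosed G S & isConjClosed G S}.

Section SubgroupType.
Variables (G : groupType) (H : groupClosed G).

Definition subgroup_of := {x : G | x \in H}.

Lemma subgroup_of_closed : group_closed (fun x : G => x \in H).
Proof. by split; [exact: gpred1 | exact: gpredF]. Qed.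

HB.instance Definition _ := SubChoice.on subgroup_of.
HB.instance Definition _ :=
  SubChoice_isSubGroup.Build G (fun x : G => x \in H) subgroup_of
    subgroup_of_closed.

End SubgroupType.

Section Quotient.
Variables (G : groupType) (N : normalClosed G).

Definition coset_rel : rel G := fun x y => x^-1 * y \in N.

Lemma coset_rel_refl : reflexive coset_rel.
Proof. by move=> x; rewrite /coset_rel mulVg gpred1. Qed.

Lemma coset_rel_sym : symmetric coset_rel.
Proof. by move=> x y; rewrite /coset_rel -gpredV invgM invgK. Qed.

Lemma coset_rel_trans : transitive coset_rel.
Proof.
move=> y x z xy yz; rewrite /coset_rel.
by rewrite -[z](mulVKg y) mulgA gpredM.
Qed.

Canonical coset_equiv :=
  EquivRel coset_rel coset_rel_refl coset_rel_sym coset_rel_trans.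

Definition quotient_group := {eq_quot coset_rel}%qT.
HB.instance Definition _ := Choice.on quotient_group.
HB.instance Definition _ := EqQuotient.on quotient_group.

Definition quotient_proj (x : G) : quotient_group := \pi_quotient_group%qT x.

Lemma quotient_projP x y :
  reflect (quotient_proj x = quotient_proj y) (x^-1 * y \in N).
Proof. exact: (@eqmodP _ coset_equiv x y). Qed.

Lemma quotient_reprK q : quotient_proj (repr q) = q.
Proof. exact: reprK. Qed.

Lemma mem_repr_proj x : (repr (quotient_proj x))^-1 * x \in N.
Proof. by apply/quotient_projP; rewrite quotient_reprK. Qed.

Definition quotient_one : quotient_group := quotient_proj 1.
Definition quotient_mul (a b : quotient_group) : quotient_group :=
  quotient_proj (repr a * repr b).
Definition quotient_inv (a : quotient_group) : quotient_group :=
  quotient_proj (repr a)^-1.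

Lemma quotient_projM x y :
  quotient_proj (x * y) = quotient_mul (quotient_proj x) (quotient_proj y).
Proof.
apply/esym/quotient_projP; set a := repr _; set b := repr _.
have xa : a^-1 * x \in N by exact: mem_repr_proj.
have yb : b^-1 * y \in N by exact: mem_repr_proj.
have -> : (a * b)^-1 * (x * y) = (a^-1 * x) ^ b * (b^-1 * y).
  by rewrite /conjg invgM !mulgA mulgK.
by rewrite gpredM // gpred_conj.
Qed.

Lemma quotient_projV x :
  quotient_proj x^-1 = quotient_inv (quotient_proj x).
Proof.
apply/quotient_projP; rewrite invgK; set a := repr _.
have xa : a^-1 * x \in N by exact: mem_repr_proj.
have := gpred_conj _ a^-1 xa.
by rewrite /conjg invgK mulgA mulVKg.
Qed.

Lemma quotient_mulA : associative quotient_mul.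
Proof.
move=> a b c; rewrite -[a]quotient_reprK -[b]quotient_reprK.
by rewrite -[c]quotient_reprK -!quotient_projM mulgA.
Qed.

Lemma quotient_mul1g : left_id quotient_one quotient_mul.
Proof. by move=> a; rewrite -[a]quotient_reprK -quotient_projM mul1g. Qed.

Lemma quotient_mulg1 : right_id quotient_one quotient_mul.
Proof. by move=> a; rewrite -[a]quotient_reprK -quotient_projM mulg1. Qed.

Lemma quotient_mulVg : left_inverse quotient_one quotient_inv quotient_mul.
Proof.
move=> a; rewrite -[a]quotient_reprK -quotient_projV -quotient_projM.
by rewrite mulVg.
Qed.

Lemma quotient_mulgV : right_inverse quotient_one quotient_inv quotient_mul.
Proof.
move=> a; rewrite -[a]quotient_reprK -quotient_projV -quotient_projM.
by rewrite mulgV.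
Qed.

HB.instance Definition _ := isGroup.Build quotient_group
  quotient_mulA quotient_mul1g quotient_mulg1 quotient_mulVg quotient_mulgV.

HB.instance Definition _ :=
  isMultiplicative.Build G quotient_group quotient_proj quotient_projM.

Lemma quotient_projMg : {morph quotient_proj : x y / x * y}.
Proof. exact: quotient_projM. Qed.

Lemma quotient_projVg : {morph quotient_proj : x / x^-1}.
Proof. exact: quotient_projV. Qed.

End Quotient.

Section InducedMaps.
Variables (G : groupType) (phi : {multiplicative G -> G}).

Section Restriction.
Variables (H : groupClosed G) (phiH : phi @` [set` H] = [set` H]).

Lemma invariant_mem x : x \in H -> phi x \in H.
Proof. by move=> xH; have : [set` H] (phi x) by rewrite -phiH; exists x. Qed.

Definition restriction (x : subgroup_of H) : subgroup_of H :=
  exist _ (phi (val x)) (invariant_mem (valP x)).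

Lemma restrictionM : {morph restriction : x y / x * y}.
Proof. by move=> x y; apply/val_inj; rewrite /= gmulfM. Qed.

HB.instance Definition _ := isMultiplicative.Build
  (subgroup_of H) (subgroup_of H) restriction restrictionM.

End Restriction.

Section QuotientMap.
Variables (N : normalClosed G) (phiN : phi @` [set` N] = [set` N]).

(* phi is applied to a chosen representative; phi(N) = N makes the result
   independent of that choice (quotient_map_proj) and multiplicative. *)
Definition quotient_map of phi @` [set` N] = [set` N] :=
  fun q : quotient_group N => quotient_proj N (phi (repr q)).

Lemma quotient_map_proj x :
  quotient_map phiN (quotient_proj N x) = quotient_proj N (phi x).
Proof.
apply/quotient_projP; set a := repr _.
have -> : (phi a)^-1 * phi x = phi (a^-1 * x).
  by apply: (can_inj (mulKg (phi a))); rewrite mulVKg -gmulfM mulVKg.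
exact/(invariant_mem phiN)/mem_repr_proj.
Qed.

Lemma quotient_mapM : {morph quotient_map phiN : a b / a * b}.
Proof.
move=> a b; rewrite -[a]quotient_reprK -[b]quotient_reprK -gmulfM.
by rewrite !quotient_map_proj !gmulfM.
Qed.

HB.instance Definition _ := isMultiplicative.Build
  (quotient_group N) (quotient_group N) (quotient_map phiN) quotient_mapM.

End QuotientMap.
End InducedMaps.

Section Center.
Variable G : groupType.

Definition trivial_subgroup : {pred G} := pred1 1.

Lemma trivial_subgroup_closed : group_closed trivial_subgroup.
Proof.
split=> [|x y]; first by rewrite inE.
by rewrite !inE => /eqP-> /eqP->; rewrite divgg.
Qed.

Lemma trivial_subgroup_conj x y :
  x \in trivial_subgroup -> x ^ y \in trivial_subgroup.
Proof. by rewrite !inE => /eqP->; rewrite conj1g. Qed.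

HB.instance Definition _ := isMulClosed.Build G trivial_subgroup
  (group_closedM trivial_subgroup_closed).
HB.instance Definition _ := isMul1Closed.Build G trivial_subgroup
  trivial_subgroup_closed.1.
HB.instance Definition _ := isInvClosed.Build G trivial_subgroup
  (group_closedV trivial_subgroup_closed).
HB.instance Definition _ := isConjClosed.Build G trivial_subgroup
  trivial_subgroup_conj.

Definition group_center : {pred G} := [pred x | `[< forall y, commute x y >]].

Lemma group_centerP x :
  reflect (forall y, commute x y) (x \in group_center).
Proof. by rewrite inE; exact: asboolP. Qed.

End Center.

Arguments trivial_subgroup : clear implicits.
Arguments group_center : clear implicits.

Section UpperCentral.
Variable G : groupType.

(* For Z = Z_n(G), the normal subgroup Z_(n+1)(G), determined by
   Z_(n+1)(G)/Z = Z(G/Z). *)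
Definition center_preim (Z : normalClosed G) : {pred G} :=
  [pred x | quotient_proj Z x \in group_center (quotient_group Z)].

Variable Z : normalClosed G.

Lemma center_preimP x :
  reflect (forall y, commute (quotient_proj Z x) (quotient_proj Z y))
          (x \in center_preim Z).
Proof.
rewrite [_ \in center_preim _]inE; apply: (iffP (group_centerP _)) => [xC y|xC q].
  exact: xC.
by rewrite -[q]quotient_reprK; exact: xC.
Qed.

Lemma center_preim1 : 1 \in center_preim Z.
Proof. by apply/center_preimP => y; rewrite /commute -!quotient_projMg mulg1 mul1g. Qed.

Lemma center_preimM : mulg_closed (center_preim Z).
Proof.
move=> x y /center_preimP xC /center_preimP yC; apply/center_preimP => z.
by rewrite quotient_projMg; apply/commute_sym/commuteM; apply/commute_sym.
Qed.

Lemma center_preimV : invg_closed (center_preim Z).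
Proof.
move=> x /center_preimP xC; apply/center_preimP => z.
by rewrite quotient_projVg; apply/commute_sym/commuteV/commute_sym/xC.
Qed.

Lemma center_preim_conj x y : x \in center_preim Z -> x ^ y \in center_preim Z.
Proof.
move=> /center_preimP xC; apply/center_preimP => z.
suff -> : quotient_proj Z (x ^ y) = quotient_proj Z x by exact: xC.
by rewrite conjgE !quotient_projMg (xC y) -!quotient_projMg mulKg.
Qed.

HB.instance Definition _ :=
  isMulClosed.Build G (center_preim Z) center_preimM.
HB.instance Definition _ :=
  isMul1Closed.Build G (center_preim Z) center_preim1.
HB.instance Definition _ :=
  isInvClosed.Build G (center_preim Z) center_preimV.
HB.instance Definition _ :=
  isConjClosed.Build G (center_preim Z) center_preim_conj.

End UpperCentral.

Fixpoint upper_central (G : groupType) (n : nat) : normalClosed G :=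
  if n is m.+1 then NormalClosed.clone G (center_preim (upper_central G m)) _
  else NormalClosed.clone G (trivial_subgroup G) _.

Definition omega_hypercentral (G : groupType) : Prop :=
  [set: G] = \bigcup_n [set` upper_central G n].

Definition torsion_group (G : groupType) : Prop :=
  forall x : G, exists2 n : nat, (0 < n)%N & x ^+ n = 1.

Section Entropy.
Local Open Scope fset_scope.
Local Open Scope ring_scope.
Variables (R : realType) (G : groupType).

Definition fset_mulg (A B : {fset G}) : {fset G} :=
  [fset (x * y)%g | x in A, y in B].

Variable phi : {multiplicative G -> G}.

(* trajectory F n is T_n(phi, F), with T_0 = {1}. *)
Fixpoint trajectory (F : {fset G}) (n : nat) : {fset G} :=
  if n is m.+1 then fset_mulg (trajectory F m) [fset iter m phi x | x in F]
  else [fset 1%g].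

Definition entropy_at (F : {fset G}) : \bar R :=
  limn_esup (fun n => (ln #|` trajectory F n|%:R / n%:R)%:E).

Definition entropy : \bar R :=
  ereal_sup [set entropy_at F | F in [set F : {fset G} | F != fset0]].

End Entropy.

(* Main.v *)
Require Import Defs.
From HB Require Import structures.
From mathcomp Require Import all_boot generic_quotient all_order all_algebra finmap.
From mathcomp Require Import all_classical all_reals all_analysis.
From mathcomp Require Import lra.

(** The entropy of an invariant subgroup A, meaning the supremum of H(phi, F)
over the finite F inside A, is additive along central extensions. If r maps
(G, phi) equivariantly to (H, psi) and the part K of A killed by r commutes
with A, then h(A) = h(K) + h(r(A)) ([entropy_on_central]), for two elementary
reasons.

- For E inside K and F inside A, T_n(EF) = T_n(E) T_n(F) has at least
  |T_n(E)| |T_n(r(F))| elements, because r separates the second factor.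
- For F inside A and N > 0, T_N(F) is contained in S E, where S picks one
  element in each fibre of r on T_N(F) and E is a finite subset of K. As E is
  central, |T_kN(F)| <= |S|^k |T_kN(E)|, where |S| = |T_N(r(F))|. Taking N
  large gives H(phi, F) <= H(psi, r(F)) + h(K).

Both estimates use that the limsup in H(phi, F) is a limit and is at most
(1/n) log |T_n(phi, F)| for every n > 0, which is Fekete's lemma ([fekete]).

Each Z_n = Z_n(G) is preserved by the automorphism phi, and h is continuous
along increasing unions, so additivity along the central factors gives series

  h(G)   = sum_j h(Z_(j+1) / Z_j),
  h(H)   = sum_j h((H cap Z_(j+1)) Z_j / Z_j),
  h(G/H) = sum_j h(Z_(j+1) H / Z_j H)

([entropy_series], [entropy_restriction_series], [entropy_quotient_series]).
The j-th terms satisfy the addition formula because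
(H cap Z_(j+1)) Z_j / Z_j lies in the abelian group Z_(j+1) / Z_j with quotient
Z_(j+1) H / Z_j H, and nonnegative series add termwise.

If G is torsion, every finite subset of Z_(j+1) / Z_j lies in a finite subgroup
K. Then T_n(K) is a finite subgroup and the index of T_n(K) in T_(n+1)(K)
decreases with n, so it is eventually a constant alpha and H(K) = log alpha
([entropy_at_submonoid]). The values +oo and log alpha are closed under sums and
suprema ([log_nat_sup]): a bounded set of logarithms of integers has a
maximum. *)

Set Implicit Arguments.
Unset Strict Implicit.
Unset Printing Implicit Defensive.

Import Order.TTheory GRing.Theory Num.Theory.
Import numFieldNormedType.Exports.
Local Open Scope classical_set_scope.
Local Open Scope fset_scope.
Local Open Scope group_scope.

(** * Products of finite subsets of a group *)

Lemma card_fsetM (K K' : choiceType) (A : {fset K}) (B : {fset K'}) :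
  #|` A `*` B| = (#|` A| * #|` B|)%N.
Proof.
rewrite -(size_allpairs pair); apply/perm_size/uniq_perm.
- exact: fset_uniq.
- by apply: allpairs_uniq; rewrite ?fset_uniq // => -[? ?] [? ?] _ _ [-> ->].
move=> [x y]; rewrite in_fsetM; apply/andP/allpairsP => [[xA yB]|].
  by exists (x, y).
by move=> [[x' y'] [? ? [-> ->]]].
Qed.

Lemma fset_section (K K' : choiceType) (r : K -> K') (T : {fset K}) (x0 : K) :
  exists s : K' -> K,
    forall y, y \in [fset r x | x in T] -> s y \in T /\ r (s y) = y.
Proof.
have /choice[s sP] : forall y, exists x,
    y \in [fset r x | x in T] -> x \in T /\ r x = y.
  move=> y; have [/imfsetP[x /= xT ->]|_] := boolP (y \in [fset r x | x in T]).
    by exists x.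
  by exists x0.
by exists s.
Qed.

Section FsetProducts.
Variable G : groupType.
Implicit Types (A B C D : {fset G}) (x y : G).

Lemma fset_mulgP A B z :
  reflect (exists x y, [/\ x \in A, y \in B & z = x * y]) (z \in fset_mulg A B).
Proof.
apply: (iffP (imfset2P _ _ _ _ _)) => [[x xA [y yB ->]]|[x [y [xA yB ->]]]].
  by exists x, y.
by exists x => //; exists y.
Qed.

Lemma mem_fset_mulg A B x y : x \in A -> y \in B -> x * y \in fset_mulg A B.
Proof. by move=> xA yB; apply/fset_mulgP; exists x, y. Qed.

Lemma fset_mulgA A B C :
  fset_mulg A (fset_mulg B C) = fset_mulg (fset_mulg A B) C.
Proof.
apply/fsetP => z; apply/fset_mulgP/fset_mulgP.
  move=> [x [_ [xA /fset_mulgP[y [w [yB wC ->]]] ->]]].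
  by exists (x * y), w; rewrite mem_fset_mulg // mulgA.
move=> [_ [w [/fset_mulgP[x [y [xA yB ->]]] wC ->]]].
by exists x, (y * w); rewrite mem_fset_mulg // mulgA.
Qed.

Lemma fset_mul1g A : fset_mulg [fset 1] A = A.
Proof.
apply/fsetP => z; apply/fset_mulgP/idP => [[_ [y [/fset1P-> yA ->]]]|zA].
  by rewrite mul1g.
by exists 1, z; rewrite inE eqxx mul1g.
Qed.

Lemma fset_mulg1 A : fset_mulg A [fset 1] = A.
Proof.
apply/fsetP => z; apply/fset_mulgP/idP => [[x [_ [xA /fset1P-> ->]]]|zA].
  by rewrite mulg1.
by exists z, 1; rewrite inE eqxx mulg1.
Qed.

Lemma fset_mulg_subset A B C D :
  A `<=` C -> B `<=` D -> fset_mulg A B `<=` fset_mulg C D.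
Proof.
move=> /fsubsetP AC /fsubsetP BD; apply/fsubsetP.
by move=> _ /fset_mulgP[x [y [/AC xC /BD yD ->]]]; exact: mem_fset_mulg.
Qed.

Lemma fset_mulg_commute A B :
  (forall x y, x \in A -> y \in B -> commute x y) ->
  fset_mulg A B = fset_mulg B A.
Proof.
move=> AB; apply/fsetP => z.
apply/fset_mulgP/fset_mulgP => -[x [y [xs ys ->]]]; exists y, x; split=> //.
  exact: AB.
exact/commute_sym/AB.
Qed.

Lemma fset_mulg_neq0 A B : A != fset0 -> B != fset0 -> fset_mulg A B != fset0.
Proof.
move=> /fset0Pn[x xA] /fset0Pn[y yB]; apply/fset0Pn; exists (x * y).
exact: mem_fset_mulg.
Qed.

Lemma card_fset_mulg A B : (#|` fset_mulg A B| <= #|` A| * #|` B|)%N.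
Proof.
rewrite -card_fsetM.
have : (#|` [fset (u.1 * u.2)%g | u in A `*` B]| <= #|` A `*` B|)%N.
  exact: leq_imfset_card.
apply: leq_trans; apply: fsubset_leq_card; apply/fsubsetP => _ /fset_mulgP[x [y [xA yB ->]]].
by apply/imfsetP; exists (x, y); rewrite // in_fsetM xA.
Qed.

Lemma hom1 (H : groupType) (f : {multiplicative G -> H}) : f 1 = 1.
Proof. by apply: (mulgI (f 1)); rewrite -gmulfM !mulg1. Qed.

Lemma homV (H : groupType) (f : {multiplicative G -> H}) x : f x^-1 = (f x)^-1.
Proof. by apply: (mulgI (f x)); rewrite -gmulfM !mulgV hom1. Qed.

End FsetProducts.

Lemma homX (G H : groupType) (f : {multiplicative G -> H}) x n :
  f (x ^+ n) = f x ^+ n.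
Proof. by elim: n => [|n IH]; rewrite ?expg0 ?hom1 // !expgS gmulfM IH. Qed.

Lemma imfset_mulg (G H : groupType) (f : G -> H) (A B : {fset G}) :
  {morph f : x y / x * y} ->
  [fset f x | x in fset_mulg A B] =
  fset_mulg [fset f x | x in A] [fset f x | x in B].
Proof.
move=> fM; apply/fsetP => z; apply/imfsetP/fset_mulgP => /=.
  move=> [_ /fset_mulgP[x [y [xA yB ->]]] ->]; exists (f x), (f y).
  by rewrite fM !in_imfset.
move=> [_ [_ [/imfsetP[x xA ->] /imfsetP[y yB ->] ->]]].
by exists (x * y); rewrite ?fM ?mem_fset_mulg.
Qed.

Lemma card_fset_mulg_ge (G H : groupType) (r : {multiplicative G -> H})
    (U T : {fset G}) : (forall x, x \in U -> r x = 1) ->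
  (#|` U| * #|` [fset r x | x in T]| <= #|` fset_mulg U T|)%N.
Proof.
move=> rU; have [s sP] := fset_section r T 1.
pose f (u : G * H) := u.1 * s u.2.
have f_inj : {in U `*` [fset r x | x in T] &, injective f}.
  move=> [x y] [x' y']; rewrite !in_fsetM /f /= => /andP[xU yT] /andP[xU' yT'] fE.
  have yy : y = y'.
    have := congr1 r fE; rewrite !gmulfM (rU x xU) (rU x' xU') !mul1g.
    by have [_ ->] := sP y yT; have [_ ->] := sP y' yT'.
  by move: fE; rewrite yy => /mulIg ->.
rewrite -card_fsetM -(card_in_imfset imfset_key f_inj).
apply: fsubset_leq_card; apply/fsubsetP => _ /imfsetP[[x y] /= + ->].
by rewrite in_fsetM /= => /andP[xU /sP[yT _]]; exact: mem_fset_mulg.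
Qed.

(** * Trajectories *)

Section Trajectory.
Variables (G : groupType) (phi : {multiplicative G -> G}).
Implicit Types (E F : {fset G}) (A : set G).

Lemma iter_homM n : {morph iter n phi : x y / x * y}.
Proof. by elim: n => // n IH x y; rewrite !iterS IH gmulfM. Qed.

Lemma iter_hom1 n : iter n phi 1 = 1.
Proof. by elim: n => // n IH; rewrite iterS IH hom1. Qed.

Lemma iter_closed A n x : (forall y, A y -> A (phi y)) -> A x -> A (iter n phi x).
Proof. by move=> Aphi Ax; elim: n => // n IH; rewrite iterS; exact: Aphi. Qed.

Lemma trajectory1 F : trajectory phi F 1 = F.
Proof.
rewrite /= fset_mul1g; apply/fsetP => x; apply/imfsetP/idP => /= [[y yF ->]//|xF].
by exists x.
Qed.

(** Since phi^n is multiplicative, the last m factors of T_(n+m)(F) are the image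
of T_m(F) under phi^n. *)
Lemma trajectory_add F n m :
  trajectory phi F (n + m) =
  fset_mulg (trajectory phi F n) [fset iter n phi x | x in trajectory phi F m].
Proof.
elim: m => [|m IH]; rewrite ?addn0 ?addnS /=.
  rewrite -[LHS]fset_mulg1; congr fset_mulg.
  apply/fsetP => x; rewrite inE; apply/eqP/imfsetP => /= [->|[y /fset1P -> ->]].
    by exists 1; rewrite ?inE // iter_hom1.
  by rewrite iter_hom1.
rewrite IH -fset_mulgA imfset_mulg; last exact: iter_homM.
congr (fset_mulg _ (fset_mulg _ _)).
apply/fsetP => x; apply/imfsetP/imfsetP => /= [[y yF ->]|[_ /imfsetP[y yF ->] ->]].
  by exists (iter m phi y); rewrite ?in_imfset ?iterD.
by exists y; rewrite ?iterD.
Qed.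

Lemma trajectory_subset F E n : E `<=` F -> trajectory phi E n `<=` trajectory phi F n.
Proof.
move=> EF; elim: n => [|n IH] /=; first exact: fsubset_refl.
by apply: fset_mulg_subset => //; apply: subset_imfset; apply/fsubsetP.
Qed.

Lemma trajectory_neq0 F n : F != fset0 -> trajectory phi F n != fset0.
Proof.
move=> F0; elim: n => [|n IH] /=; first by apply/fset0Pn; exists 1; rewrite inE.
apply: fset_mulg_neq0 => //; case/fset0Pn: F0 => x xF; apply/fset0Pn.
by exists (iter n phi x); rewrite in_imfset.
Qed.

Lemma trajectory_mem1 F n : 1 \in F -> 1 \in trajectory phi F n.
Proof.
move=> F1; elim: n => [|n IH] /=; first by rewrite inE.
apply/fset_mulgP; exists 1, 1; split; rewrite ?mulg1 //.
by apply/imfsetP; exists 1 => //; rewrite iter_hom1.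
Qed.

Lemma sub_trajectory F n : 1 \in F -> (0 < n)%N -> F `<=` trajectory phi F n.
Proof.
case: n => // n F1 _; rewrite -add1n trajectory_add trajectory1.
apply/fsubsetP => x xF; rewrite -[x]mulg1 mem_fset_mulg //.
by apply/imfsetP; exists 1; rewrite /= ?hom1 ?trajectory_mem1.
Qed.

Lemma trajectory_in A F n :
  A 1 -> (forall x y, A x -> A y -> A (x * y)) -> (forall x, A x -> A (phi x)) ->
  (forall x, x \in F -> A x) -> forall x, x \in trajectory phi F n -> A x.
Proof.
move=> A1 AM Aphi FA; elim: n => [|n IH] x /=; first by move/fset1P->.
move=> /fset_mulgP[y [_ [yT /imfsetP[z /= zF ->] ->]]].
by apply: AM; [exact: IH | apply: iter_closed => //; exact: FA].
Qed.

Lemma trajectory_commute F n x :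
  (forall j y, y \in F -> commute x (iter j phi y)) ->
  forall y, y \in trajectory phi F n -> commute x y.
Proof.
move=> xF; elim: n => [|n IH] y /=; first by move/fset1P->; exact: commute1.
move=> /fset_mulgP[z [_ [zT /imfsetP[w /= wF ->] ->]]].
by apply: commuteM; [exact: IH | exact: xF].
Qed.

(** The factors of (EF) phi(EF) ... can be sorted, all the iterates of E being
moved to the left of those of F. *)
Lemma trajectory_mulg E F n :
  (forall i j x y, x \in E -> y \in F -> commute (iter i phi x) (iter j phi y)) ->
  trajectory phi (fset_mulg E F) n =
  fset_mulg (trajectory phi E n) (trajectory phi F n).
Proof.
move=> EF; elim: n => [|n IH] /=; first by rewrite fset_mul1g.
rewrite IH imfset_mulg; last exact: iter_homM.
set TE := trajectory _ E n; set TF := trajectory _ F n.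
set iE := [fset _ | x in E]; set iF := [fset _ | x in F].
rewrite -!fset_mulgA; congr fset_mulg; rewrite !fset_mulgA; congr fset_mulg.
apply: fset_mulg_commute => x _ xT /imfsetP[y /= yE ->].
by apply/commute_sym/(trajectory_commute _ xT) => j z; exact: EF.
Qed.

End Trajectory.

Lemma trajectory_hom (G H : groupType) (phi : {multiplicative G -> G})
    (psi : {multiplicative H -> H}) (r : {multiplicative G -> H}) F n :
  (forall x, r (phi x) = psi (r x)) ->
  [fset r x | x in trajectory phi F n] = trajectory psi [fset r x | x in F] n.
Proof.
move=> rphi; elim: n => [|n IH] /=.
  apply/fsetP => x; rewrite inE; apply/imfsetP/eqP => /= [[y /fset1P -> ->]|->].
    by rewrite hom1.
  by exists 1; rewrite ?inE ?hom1.
rewrite imfset_mulg; last exact: gmulfM.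
rewrite IH; congr fset_mulg.
have ri m x : r (iter m phi x) = iter m psi (r x).
  by elim: m => // m IHm; rewrite !iterS rphi IHm.
apply/fsetP => z; apply/imfsetP/imfsetP => /=.
  by move=> [_ /imfsetP[x xF ->] ->]; exists (r x); rewrite ?in_imfset ?ri.
move=> [_ /imfsetP[x xF ->] ->]; exists (iter n phi x); rewrite ?in_imfset ?ri //.
Qed.

(** * Growth rates and Fekete's lemma *)

Section Rate.
Local Open Scope ring_scope.
Variable R : realType.
Implicit Types (a : nat -> R) (c : R).

(** The quotient a_n / n tends to c, and c is also its infimum. In this form,
one inequality between rates follows from the inequality between two terms. *)
Definition rate a c :=
  [/\ 0 <= c, forall n, c * n%:R <= a n &
      forall e, 0 < e -> exists N, forall n, (N <= n)%N -> a n <= (c + e) * n%:R].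

(** Cut n into blocks of length m, where a_m / m is nearly the infimum; the
incomplete last block contributes a bounded amount. *)
Lemma fekete a : (forall n, 0 <= a n) ->
  (forall n m, a (n + m)%N <= a n + a m) -> exists c, rate a c.
Proof.
move=> a0 aD.
pose S := [set a n / n%:R | n in [set n : nat | (0 < n)%N]].
have S0 : S !=set0 by exists (a 1%N / 1%:R); exists 1%N.
have Slb : lbound S 0 by move=> _ [n _ <-]; rewrite divr_ge0.
have Shlb : has_lbound S by exists 0.
exists (inf S); split.
- exact: lb_le_inf.
- case=> [|n]; first by rewrite mulr0.
  rewrite -ler_pdivlMr ?ltr0Sn //; apply: ge_inf => //.
  by exists n.+1.
move=> e e0.
have e20 : 0 < e / 2 by rewrite divr_gt0.
(* The slack e is split between the choice of m and the last block. *)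
have [_ [m /= m0 <-] am] := inf_adherent e20 (conj S0 Shlb).
have m0' : 0 < m%:R :> R by rewrite ltr0n.
set d := inf S + e / 2 in am.
have {}am : a m <= d * m%:R by rewrite -ler_pdivrMr //; exact: ltW.
have d0 : 0 <= d by rewrite addr_ge0 ?(ltW e20) //; exact: lb_le_inf.
pose C := \sum_(i < m) a i.
have aC r : (r < m)%N -> a r <= C.
  move=> rm; rewrite /C (bigD1 (Ordinal rm)) //= lerDl.
  by apply: sumr_ge0 => i _; exact: a0.
have aq q r : a (q * m + r)%N <= q%:R * a m + a r.
  elim: q => [|q IH]; first by rewrite mul0n mul0r add0n add0r.
  rewrite mulSn -addnA; apply: le_trans (aD _ _) _.
  by rewrite -natr1 mulrDl mul1r; lra.
have [N NC] : exists N : nat, C / (e / 2) <= N%:R.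
  exists (Num.truncn (C / (e / 2))).+1; apply/ltW/truncnS_gt.
exists N => n Nn.
rewrite {1}(divn_eq n m); apply: le_trans (aq _ _) _.
have C1 : a (n %% m)%N <= C by apply: aC; rewrite ltn_mod.
have C2 : C <= n%:R * (e / 2).
  by rewrite -ler_pdivrMr //; apply: le_trans NC _; rewrite ler_nat.
have C3 : (n %/ m)%:R * a m <= d * n%:R.
  apply: (@le_trans _ _ (d * (n %/ m * m)%:R)).
    by rewrite natrM [_%:R * m%:R]mulrC mulrA mulrC ler_wpM2r.
  by rewrite ler_wpM2l // ler_nat leq_trunc_div.
have -> : (inf S + e) * n%:R = d * n%:R + n%:R * (e / 2) by rewrite /d; lra.
by rewrite lerD // (le_trans C1).
Qed.

Lemma rate_limn_esup a c : rate a c -> limn_esup (fun n => (a n / n%:R)%:E) = c%:E.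
Proof.
move=> [_ ca ac].
have cv : (fun n => (a n / n%:R)%:E) @ \oo --> c%:E.
  apply: cvg_EFin; first by near=> n.
  apply/cvgrPdist_le => e e0; have [N aN] := ac _ e0.
  near=> n.
  have n0 : 0 < n%:R :> R by rewrite ltr0n; near: n; exists 1%N.
  have l1 : c <= a n / n%:R by rewrite ler_pdivlMr.
  have l2 : a n / n%:R <= c + e.
    by rewrite ler_pdivrMr //; apply: aN; near: n; exists N.
  by rewrite /= ler_norml; lra.
rewrite is_cvg_limn_esupE; first exact/cvg_lim.
by apply/cvg_ex; exists c%:E.
Unshelve. all: by end_near. Qed.

Lemma archi_le0 (x D : R) : (forall n : nat, n%:R * x <= D) -> x <= 0.
Proof.
move=> xD; rewrite leNgt; apply/negP => x0.
have := xD (Num.truncn (D / x)).+1; rewrite -ler_pdivlMr //.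
by rewrite leNgt truncnS_gt.
Qed.

Lemma rate_affine a c k C L : rate a c ->
  (forall n, a (k + n)%N = C + n%:R * L) -> c = L.
Proof.
move=> [_ ca ac] aE; apply/le_anti/andP; split.
  rewrite -subr_le0; apply: (@archi_le0 _ (C - c * k%:R)) => n.
  by have := ca (k + n)%N; rewrite aE natrD; lra.
apply/ler_addgt0Pr => e e0; rewrite -subr_le0.
have [N aN] := ac _ e0.
pose D := (c + e) * (k + N)%:R - C - N%:R * L.
apply: (@archi_le0 _ D) => n.
have := aN (k + (N + n))%N; rewrite aE /D !natrD => /(_ _).
by rewrite (leq_trans (leq_addr n N)) ?leq_addl // => /(_ isT); lra.
Qed.

End Rate.

Section EntropyRate.
Local Open Scope ring_scope.
Variables (R : realType) (G : groupType) (phi : {multiplicative G -> G}).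
Implicit Types (E F : {fset G}).

Definition growth F n : R := ln #|` trajectory phi F n|%:R.

Lemma card_trajectory_gt0 F n : F != fset0 -> 0 < #|` trajectory phi F n|%:R :> R.
Proof. by move=> F0; rewrite ltr0n cardfs_gt0 trajectory_neq0. Qed.

Lemma ln_nat_ge0 n : 0 <= ln n%:R :> R.
Proof. by case: n => [|n]; [rewrite ln0 | apply: ln_ge0; rewrite ler1n]. Qed.

(** The growth is subadditive because T_(n+m)(F) is the product of T_n(F) and an
image of T_m(F). *)
Lemma entropy_atP F : F != fset0 ->
  exists2 c, entropy_at R phi F = c%:E & rate (growth F) c.
Proof.
move=> F0; have [||c rc] := @fekete R (growth F).
- by move=> n; exact: ln_nat_ge0.
- move=> n m; rewrite /growth -lnM ?posrE ?card_trajectory_gt0 //.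
  rewrite ler_ln ?posrE ?mulr_gt0 ?card_trajectory_gt0 //.
  rewrite -natrM ler_nat trajectory_add.
  apply: leq_trans (card_fset_mulg _ _) _; rewrite leq_mul2l.
  by apply/orP; right; exact: leq_imfset_card.
by exists c => //; exact: rate_limn_esup.
Qed.

Lemma entropy_at_ge0 F : F != fset0 -> (0 <= entropy_at R phi F)%E.
Proof. by move=> /entropy_atP[c -> [c0 _ _]]; rewrite lee_fin. Qed.

End EntropyRate.

(** * Additivity along central extensions *)

(** T_kN(F) is the product of the phi^(iN)(T_N(F)), each of which is covered by
phi^(iN)(S) phi^(iN)(E). As the two kinds of factors commute, those coming from S
can be gathered, at the price of |S|^k possibilities, and those coming from E lie
in T_kN(E). *)
Lemma block_cover (G : groupType) (phi : {multiplicative G -> G})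
    (E S F : {fset G}) N k :
  1 \in E -> (0 < N)%N -> trajectory phi F N `<=` fset_mulg S E ->
  (forall i j x y, x \in S -> y \in E -> commute (iter i phi x) (iter j phi y)) ->
  (#|` trajectory phi F (k * N)%N| <= #|` S| ^ k * #|` trajectory phi E (k * N)%N|)%N.
Proof.
move=> E1 N0 FSE SE.
suff [B [Bk FB]] : exists B, (#|` B| <= #|` S| ^ k)%N /\
    trajectory phi F (k * N)%N `<=` fset_mulg B (trajectory phi E (k * N)%N).
  apply: leq_trans (fsubset_leq_card FB) _; apply: leq_trans (card_fset_mulg _ _) _.
  by rewrite leq_mul2r Bk orbT.
elim: k => [|k [B [Bk FB]]].
  by exists [fset 1]; rewrite cardfs1 mul0n /= fset_mul1g fsubset_refl.
pose f := iter (k * N)%N phi.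
have fM : {morph f : x y / x * y}.
  exact: iter_homM.
exists (fset_mulg B [fset f x | x in S]); split.
  rewrite expnSr; apply: leq_trans (card_fset_mulg _ _) _; apply: leq_mul => //.
  exact: leq_imfset_card.
rewrite mulSn addnC !trajectory_add.
(* Cover T_kN(F) phi^(kN)(T_N(F)) factor by factor, then move phi^(kN)(S) to the
   left of T_kN(E). *)
have sub : fset_mulg (trajectory phi F (k * N)%N) [fset f x | x in trajectory phi F N]
    `<=` fset_mulg (fset_mulg B (trajectory phi E (k * N)%N))
       (fset_mulg [fset f x | x in S] [fset f x | x in E]).
  apply: fset_mulg_subset => //; rewrite -(imfset_mulg _ _ fM).
  by apply: subset_imfset; exact/fsubsetP.
apply: fsubset_trans sub _; rewrite -!fset_mulgA; apply: fset_mulg_subset => //.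
rewrite !fset_mulgA [X in fset_mulg X _]fset_mulg_commute; last first.
  move=> x _ xT /imfsetP[y /= yS ->].
  by apply/commute_sym/(trajectory_commute _ xT) => j z zE; exact: SE.
rewrite -!fset_mulgA; do 2!apply: fset_mulg_subset => //.
by apply: subset_imfset; apply/fsubsetP; exact: sub_trajectory.
Qed.

Lemma section_cover (G H : groupType) (r : {multiplicative G -> H}) (T : {fset G}) :
  exists S : {fset G}, [/\ S `<=` T, (#|` S| <= #|` [fset r x | x in T]|)%N &
    forall x, x \in T -> exists2 s, s \in S & r s = r x].
Proof.
have [s sP] := fset_section r T 1.
exists [fset s y | y in [fset r x | x in T]]; split.
- by apply/fsubsetP => _ /imfsetP[y /= /sP[sT _] ->].
- exact: leq_imfset_card.
move=> x xT; exists (s (r x)); first by rewrite !in_imfset.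
by have [] := sP (r x) (in_imfset _ _ xT).
Qed.

Lemma fset_lift (K K' : choiceType) (r : K -> K') (x0 : K) (A : set K)
    (F : {fset K'}) : ([set` F] `<=` r @` A)%classic ->
  exists2 F' : {fset K}, ([set` F'] `<=` A)%classic & [fset r x | x in F'] = F.
Proof.
move=> FA; have /choice[s sP] : forall y, exists x, y \in F -> A x /\ r x = y.
  move=> y; have [/FA[x Ax <-]|_] := boolP (y \in F); first by exists x.
  by exists x0.
exists [fset s y | y in F].
  by move=> _ /= /imfsetP[y /= /sP[] ? _ ->].
apply/fsetP => y; apply/imfsetP/idP => /= [[_ /imfsetP[z /= zF ->] ->]|yF].
  by have [_ ->] := sP z zF.
by exists (s y); rewrite ?in_imfset //; have [_ ->] := sP y yF.
Qed.

Section EntropyOn.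
Variables (R : realType) (G : groupType) (phi : {multiplicative G -> G}).
Implicit Types (A B : set G) (E F : {fset G}).

(** For an invariant subgroup A this is the entropy of the restriction of phi to
A. Defining it for subsets of G lets subgroups and their images in quotients be
compared without changing the group. *)
Definition entropy_on A : \bar R := ereal_sup
  [set entropy_at R phi F | F in [set F | F != fset0 /\ ([set` F] `<=` A)%classic]].

Lemma entropy_onT : entropy_on setT = entropy R phi.
Proof.
congr ereal_sup; apply/seteqP; split => _ [F FP <-]; exists F => //.
by case: FP.
Qed.

Lemma entropy_at_le_on A F : F != fset0 -> ([set` F] `<=` A)%classic ->
  (entropy_at R phi F <= entropy_on A)%E.
Proof. by move=> F0 FA; apply: ereal_sup_ubound; exists F. Qed.

Lemma entropy_on_le A x :
  (forall F, F != fset0 -> ([set` F] `<=` A)%classic -> (entropy_at R phi F <= x)%E) ->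
  (entropy_on A <= x)%E.
Proof. by move=> Ax; apply: ge_ereal_sup => _ [F [F0 FA] <-]; exact: Ax. Qed.

Lemma entropy_on_ge0 A x : A x -> (0 <= entropy_on A)%E.
Proof.
move=> Ax; have x0 : [fset x] != fset0 by apply/fset0Pn; exists x; rewrite inE.
apply: le_trans (entropy_at_ge0 R phi x0) (entropy_at_le_on x0 _).
by move=> y /= /fset1P->.
Qed.

Lemma entropy_on_subset A B : (A `<=` B)%classic -> (entropy_on A <= entropy_on B)%E.
Proof.
move=> AB; apply: entropy_on_le => F F0 FA; apply: entropy_at_le_on => //.
exact: subset_trans AB.
Qed.

(** A finite subset of an increasing union lies in one of its members. *)
Lemma entropy_on_bigcup (A : nat -> set G) :
  (forall m n, (m <= n)%N -> (A m `<=` A n)%classic) ->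
  entropy_on (\bigcup_n A n) = ereal_sup (range (fun n => entropy_on (A n))).
Proof.
move=> Amono; apply/le_anti/andP; split; last first.
  apply: ge_ereal_sup => _ [n _ <-]; apply: entropy_on_subset => x Ax.
  by exists n.
apply: entropy_on_le => F F0 FA.
have [n FAn] : exists n, ([set` F] `<=` A n)%classic.
  have /choice[i iP] : forall x, exists n, x \in F -> A n x.
    move=> x; have [/FA[n _ Ax]|_] := boolP (x \in F); first by exists n.
    by exists 0%N.
  exists (\max_(x <- F) i x)%N => x /= xF; apply: Amono (iP x xF).
  exact: leq_bigmax_seq.
apply: le_trans (entropy_at_le_on F0 FAn) _.
by apply: ereal_sup_ubound; exists n.
Qed.

Lemma entropy_at_subset E F : E != fset0 -> E `<=` F ->
  (entropy_at R phi E <= entropy_at R phi F)%E.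
Proof.
move=> E0 EF.
have F0 : F != fset0.
  by case/fset0Pn: E0 => x xE; apply/fset0Pn; exists x; exact: (fsubsetP EF).
have [c -> [_ cE _]] := entropy_atP R phi E0.
have [d -> [_ _ dF]] := entropy_atP R phi F0.
rewrite lee_fin; apply/ler_addgt0Pr => e e0; have [N FN] := dF _ e0.
have N0 : (0 < N.+1%:R :> R)%R by rewrite ltr0n.
rewrite -(ler_pM2r N0); apply: le_trans (cE _) _.
apply: le_trans (FN _ (leqnSn N)).
rewrite ler_ln ?posrE ?card_trajectory_gt0 // ler_nat.
exact/fsubset_leq_card/trajectory_subset.
Qed.

End EntropyOn.

Definition invariant_subgroup (G : groupType) (phi : G -> G) (A : set G) :=
  [/\ A 1, forall x y, A x -> A y -> A (x * y), forall x, A x -> A x^-1 &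
      forall x, A x -> A (phi x)].

Section CentralExtension.
Variables (R : realType) (G H : groupType).
Variables (phi : {multiplicative G -> G}) (psi : {multiplicative H -> H}).
Variables (r : {multiplicative G -> H}) (A : set G).
Hypothesis r_phi : forall x, r (phi x) = psi (r x).
Hypothesis A_inv : invariant_subgroup phi A.
Hypothesis A_central : forall x y, A x -> r x = 1 -> A y -> commute x y.

Let K := (A `&` [set x | r x = 1])%classic.

Let commute_iter i j x y : K x -> A y -> commute (iter i phi x) (iter j phi y).
Proof.
case: A_inv => A1 AM AV Aphi [Ax rx] Ay.
apply: A_central; try exact: iter_closed.
elim: i => // i IH; rewrite iterS r_phi IH hom1 //.
Qed.

(** Finite sets E in K and F in r(A), the latter lifted to A, multiply to a finite
subset of A whose trajectories have at least |T_n(E)| |T_n(F)| elements. *)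
Let entropy_at_pair E F :
  E != fset0 -> ([set` E] `<=` K)%classic ->
  F != fset0 -> ([set` F] `<=` r @` A)%classic ->
  (entropy_at R phi E + entropy_at R psi F <= entropy_on R phi A)%E.
Proof.
have [A1 AM AV Aphi] := A_inv => E0 EK F0 FA.
have [F' F'A rF'] := fset_lift 1 FA.
have F'0 : F' != fset0.
  apply: contra_neq F0 => F'0; rewrite -rF' F'0; apply/fsetP => y.
  by rewrite in_fset0; apply/negP => /imfsetP[].
pose EF := fset_mulg E F'.
have EF0 : EF != fset0 by exact: fset_mulg_neq0.
have EFA : ([set` EF] `<=` A)%classic.
  by move=> _ /= /fset_mulgP[x [y [/EK[Ax _] /F'A Ay ->]]]; exact: AM.
apply: le_trans (entropy_at_le_on R phi EF0 EFA).
have [c -> [_ cE _]] := entropy_atP R phi E0.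
have [d -> [_ dF _]] := entropy_atP R psi F0.
have [b -> [_ _ bEF]] := entropy_atP R phi EF0.
rewrite -EFinD lee_fin; apply/ler_addgt0Pr => e e0; have [N EFN] := bEF _ e0.
have N0 : (0 < N.+1%:R :> R)%R by rewrite ltr0n.
rewrite -(ler_pM2r N0); apply: le_trans (EFN _ (leqnSn N)).
rewrite mulrDl; apply: le_trans (lerD (cE _) (dF _)) _.
rewrite /growth -lnM ?posrE ?card_trajectory_gt0 //.
rewrite ler_ln ?posrE ?mulr_gt0 ?card_trajectory_gt0 // -natrM ler_nat.
rewrite trajectory_mulg; last first.
  by move=> i j x y /EK xK /F'A yA; exact: commute_iter.
rewrite -rF' -(trajectory_hom _ _ r_phi); apply: card_fset_mulg_ge => x xT.
suff [] : K x by [].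
move: x xT; apply: trajectory_in => //.
- by split => //=; exact: hom1.
- move=> z t [Az /= rz] [At /= rt]; split; first exact: AM.
  by rewrite /= gmulfM rz rt mulg1.
- by move=> z [Az /= rz]; split; [exact: Aphi | rewrite /= r_phi rz hom1].
Qed.

Let lower_bound :
  (entropy_on R phi K + entropy_on R psi (r @` A)%classic <= entropy_on R phi A)%E.
Proof.
have [A1 AM AV Aphi] := A_inv.
(* Pass to the suprema over F and E in turn. Moving the supremum over F across
   the inequality requires it to be finite, so an infinite one is treated apart. *)
have onK E : E != fset0 -> ([set` E] `<=` K)%classic ->
    (entropy_at R phi E + entropy_on R psi (r @` A)%classic <= entropy_on R phi A)%E.
  move=> E0 EK; have [c cE _] := entropy_atP R phi E0.
  rewrite cE -leeBrDl //; apply: entropy_on_le => F F0 FA.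
  by rewrite leeBrDl // -cE; exact: entropy_at_pair.
have [psi_fin|] := boolP (entropy_on R psi (r @` A)%classic \is a fin_num).
  by rewrite -leeBrDr //; apply: entropy_on_le => E E0 EK; rewrite leeBrDr //; exact: onK.
rewrite ge0_fin_numE -?leNgt; last by apply: (@entropy_on_ge0 _ _ _ _ (r 1)); exists 1.
rewrite leye_eq => /eqP psiy.
have one0 : [fset (1 : G)] != fset0 by apply/fset0Pn; exists 1; rewrite inE.
have := onK [fset 1] one0; have [c -> _] := entropy_atP R phi one0.
rewrite psiy addey // leye_eq => phiy.
have /phiy/eqP-> : ([set` [fset (1 : G)]] `<=` K)%classic.
  by move=> x /= /fset1P ->; split => //=; exact: hom1.
exact: leey.
Qed.

(** Fix N such that log |T_N(r(F))| is nearly N H(psi, r(F)). By [block_cover], the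
growth of F along the multiples of N is at most that of E plus log |S| per
block. *)
Let upper_bound :
  (entropy_on R phi A <= entropy_on R phi K + entropy_on R psi (r @` A)%classic)%E.
Proof.
have [A1 AM AV Aphi] := A_inv.
apply: entropy_on_le => F F0 FA.
pose rF := [fset r x | x in F].
have rF0 : rF != fset0.
  by case/fset0Pn: F0 => x xF; apply/fset0Pn; exists (r x); rewrite in_imfset.
have rFA : ([set` rF] `<=` r @` A)%classic.
  by move=> _ /= /imfsetP[x /= xF ->]; exists x => //; exact: FA.
have [c cE [_ cF _]] := entropy_atP R phi F0.
have [d dE [_ _ dF]] := entropy_atP R psi rF0.
suff lt_e e : (0 < e)%R -> (c%:E <= entropy_on R phi K + (d + e)%:E)%E.
  rewrite cE; apply: (@le_trans _ _ (entropy_on R phi K + d%:E)%E).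
    by apply/lee_addgt0Pr => e e0; rewrite -addeA -EFinD; exact: lt_e.
  by rewrite leeD2l // -dE; exact: entropy_at_le_on.
move=> e0; have [N0 dN0] := dF _ e0.
pose N := N0.+1; pose T := trajectory phi F N.
have N_gt0 : (0 < N%:R :> R)%R by rewrite ltr0n.
have [S [ST Scard sP]] := section_cover r T.
have TA : ([set` T] `<=` A)%classic by move=> x /=; apply: trajectory_in.
have SA : ([set` S] `<=` A)%classic by move=> x /= xS; apply: TA; exact: (fsubsetP ST).
(* The differences within the fibres of r on T; 1 is added so that E is
   contained in T_n(E) for n > 0. *)
pose E := 1 |` [fset x in [fset s^-1 * x | s in S, x in T] | r x == 1].
have EK : ([set` E] `<=` K)%classic.
  move=> x /=; rewrite in_fset1U => /orP[/eqP->|].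
    by split => //=; exact: hom1.
  rewrite !inE => /andP[/imfset2P[s /= /SA sS [t /= /TA tT ->]] /eqP rst].
  by split => //; apply: AM => //; exact: AV.
have E0 : E != fset0 by apply/fset0Pn; exists 1; rewrite in_fset1U eqxx.
have TSE : T `<=` fset_mulg S E.
  apply/fsubsetP => x xT; have [s sS rs] := sP x xT.
  rewrite -(mulVKg s x) mem_fset_mulg // in_fset1U !inE.
  apply/orP; right; apply/andP; split.
    by apply/imfset2P; exists s => //; exists x.
  by rewrite gmulfM homV rs mulVg.
have [b bE [_ _ bF]] := entropy_atP R phi E0.
have S0 : (0 < #|` S|%:R :> R)%R.
  rewrite ltr0n cardfs_gt0; apply/fset0Pn; case/fset0Pn: (trajectory_neq0 phi N F0).
  by move=> x /sP[s sS _]; exists s.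
have lnS : (ln #|` S|%:R <= (d + e) * N%:R)%R.
  apply: le_trans (dN0 N (leqnSn _)).
  rewrite ler_ln ?posrE ?card_trajectory_gt0 // ler_nat.
  by rewrite -(trajectory_hom _ _ r_phi).
apply: (@le_trans _ _ (b + (d + e))%:E); last first.
  by rewrite EFinD leeD2r // -bE; exact: entropy_at_le_on.
rewrite lee_fin; apply/ler_addgt0Pr => e' e'0; have [M bM] := bF _ e'0.
pose k := M.+1.
have kN : (M <= k * N)%N by rewrite /k /N mulnS; apply: leq_trans (leqnSn _) (leq_addr _ _).
have kN0 : (0 < (k * N)%N%:R :> R)%R by rewrite ltr0n.
rewrite -(ler_pM2r kN0); apply: le_trans (cF _) _.
have -> : ((b + (d + e) + e') * (k * N)%N%:R =
   k%:R * ((d + e) * N%:R) + (b + e') * (k * N)%N%:R)%R by rewrite natrM; lra.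
apply: (@le_trans _ _ (k%:R * ln #|` S|%:R + growth R phi E (k * N)%N)%R); last first.
  by rewrite lerD ?bM // ler_wpM2l.
rewrite mulr_natl -lnXn // -lnM ?posrE ?exprn_gt0 ?card_trajectory_gt0 //.
rewrite ler_ln ?posrE ?mulr_gt0 ?exprn_gt0 ?card_trajectory_gt0 //.
rewrite -natrX -natrM ler_nat; apply: block_cover => //.
- by rewrite in_fset1U eqxx.
- by move=> i j x y /SA xA /EK yK; apply/commute_sym; exact: commute_iter.
Qed.

Lemma entropy_on_central :
  (entropy_on R phi A =
     entropy_on R phi (A `&` [set x | r x = 1%g])%classic + entropy_on R psi (r @` A)%classic)%E.
Proof. by apply/le_anti/andP; split. Qed.

End CentralExtension.

(** * Logarithms of positive integers *)

Section LogNat.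
Variable R : realType.
Implicit Types (x y : \bar R) (S : set (\bar R)).

Definition log_nat x :=
  x = +oo%E \/ exists2 alpha : nat, (0 < alpha)%N & x = (ln alpha%:R)%:E.

Lemma log_natD x y : log_nat x -> log_nat y -> log_nat (x + y)%E.
Proof.
move=> [->|[a a0 ->]] [->|[b b0 ->]]; try by left.
right; exists (a * b)%N; first by rewrite muln_gt0 a0.
by rewrite natrM lnM ?posrE ?ltr0n.
Qed.

Lemma log_nat0 : log_nat 0%E.
Proof. by right; exists 1%N; rewrite ?ln1. Qed.

(** When the supremum b is finite, the integers involved are at most exp b, so one
of them is the largest. *)
Lemma log_nat_sup S x0 : S x0 -> (forall x, S x -> log_nat x) ->
  log_nat (ereal_sup S).
Proof.
move=> Sx0 Slog.
have [/eqP|supNy] := boolP (ereal_sup S == +oo)%E; first by left.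
right.
have lt_sup x : S x -> exists2 a : nat, (0 < a)%N & x = (ln a%:R)%:E.
  move=> Sx; case: (Slog x Sx) => // xy; case/negP: supNy.
  by rewrite -leye_eq -xy; exact: ereal_sup_ubound.
have [a0 a00 x0E] := lt_sup x0 Sx0.
have [b supb] : exists b, ereal_sup S = b%:E.
  move: (ereal_sup_ubound Sx0) supNy; rewrite x0E.
  by case: (ereal_sup S) => //= b; exists b.
pose P (a : nat) := `[< (0 < a)%N /\ S (ln a%:R)%:E >].
have exP : exists a, P a by exists a0; apply/asboolP; rewrite -x0E.
have P_le a : P a -> (a <= Num.truncn (expR b))%N.
  move=> /asboolP[a_gt0 /ereal_sup_ubound]; rewrite supb lee_fin => lnb.
  by rewrite truncn_ge_nat ?expR_ge0 // -(@lnK _ a%:R%R) ?posrE ?ltr0n // ler_expR.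
case: (ex_maxnP exP P_le) => a /asboolP[a_gt0 Sa] amax.
exists a => //; apply/le_anti/andP; split; last exact: ereal_sup_ubound.
apply: ge_ereal_sup => x Sx; have [c c0 xE] := lt_sup x Sx.
rewrite xE lee_fin ler_ln ?posrE ?ltr0n // ler_nat; apply: amax.
by apply/asboolP; rewrite -xE.
Qed.

End LogNat.

(** * Finite submonoids and their cosets *)

Section FiniteSubmonoid.
Variable G : groupType.
Implicit Types (T U : {fset G}).

(** A finite submonoid of a group is a subgroup, so these are the finite
subgroups, described without inverses. *)
Definition submonoid T := 1 \in T /\ fset_mulg T T = T.

Lemma submonoid_absorb T U : submonoid T -> 1 \in U -> U `<=` T -> fset_mulg U T = T.
Proof.
move=> [T1 TT] U1 UT; apply/eqP; rewrite eqEfsubset; apply/andP; split.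
  by rewrite -{2}TT; apply: fset_mulg_subset.
by rewrite -{1}(fset_mul1g T); apply: fset_mulg_subset; rewrite // fsub1set.
Qed.

Definition coset x T : {fset G} := fset_mulg [fset x] T.

Lemma card_coset x T : #|` coset x T| = #|` T|.
Proof.
have -> : coset x T = [fset x * t | t in T].
  apply/fsetP => y; apply/fset_mulgP/imfsetP => /= [[_ [t [/fset1P -> tT ->]]]|[t tT ->]].
    by exists t.
  by exists x, t; rewrite inE eqxx.
by rewrite card_imfset //; exact: mulgI.
Qed.

(** The coset xT is contained in T and has the same cardinality. *)
Lemma coset_absorb T x : submonoid T -> x \in T -> coset x T = T.
Proof.
move=> [T1 TT] xT; apply/eqP; rewrite eqEfcard card_coset leqnn andbT.
by rewrite -{2}TT; apply: fset_mulg_subset; rewrite // fsub1set.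
Qed.

Lemma cosetM x y T : coset (x * y) T = coset x (coset y T).
Proof.
rewrite /coset fset_mulgA; congr fset_mulg; apply/fsetP => z.
apply/fset1P/fset_mulgP => [->|[_ [_ [/fset1P -> /fset1P -> ->]]] //].
by exists x, y; rewrite !inE !eqxx.
Qed.

Definition cosets U T : {fset {fset G}} := [fset coset x T | x in U].

Lemma lagrange T U : submonoid T -> submonoid U -> T `<=` U ->
  #|` U| = (#|` cosets U T| * #|` T|)%N.
Proof.
move=> Tm [U1 UU] TU; have [T1 TT] := Tm.
have [s sP] := fset_section (coset^~ T) U 1.
pose f (u : {fset G} * G) := s u.1 * u.2.
have f_inj : {in cosets U T `*` T &, injective f}.
  move=> [D t] [D' t']; rewrite !in_fsetM /f /= => /andP[DU tT] /andP[DU' tT'] fE.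
  have DD : D = D'.
    have [_ <-] := sP _ DU; have [_ <-] := sP _ DU'.
    by rewrite -[in LHS](coset_absorb Tm tT) -cosetM fE cosetM (coset_absorb Tm tT').
  by move: fE; rewrite DD => /mulgI ->.
rewrite -card_fsetM -(card_in_imfset imfset_key f_inj); congr (#|` _|).
apply/fsetP => x; apply/idP/imfsetP => /= [xU|[[D t] /= + ->]].
  have DU : coset x T \in cosets U T by apply/imfsetP; exists x.
  have [sU sE] := sP _ DU.
  have : x \in coset (s (coset x T)) T.
    by rewrite sE; apply/fset_mulgP; exists x, 1; split; rewrite ?inE ?mulg1.
  move=> /fset_mulgP[_ [t [/fset1P -> tT xE]]].
  by exists (coset x T, t); rewrite // in_fsetM DU.
rewrite in_fsetM /= => /andP[/sP[sU _] tT]; rewrite -UU mem_fset_mulg //.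
exact: (fsubsetP TU).
Qed.

End FiniteSubmonoid.

(** * Entropy of torsion abelian groups *)

Lemma nonincreasing_stationary (d : nat -> nat) :
  (forall n, (d n.+1 <= d n)%N) -> exists k, forall n, d (k + n)%N = d k.
Proof.
move=> d_dec; pose P m := `[< exists n, d n = m >].
have exP : exists m, P m by exists (d 0%N); apply/asboolP; exists 0%N.
case: (ex_minnP exP) => m /asboolP[k <-] kmin; exists k => n.
apply/eqP; rewrite eqn_leq kmin ?andbT; last by apply/asboolP; exists (k + n)%N.
elim: n => [|n IH]; first by rewrite addn0.
by rewrite addnS; apply: leq_trans (d_dec _) IH.
Qed.

Section TorsionAbelian.
Variables (R : realType) (G : groupType) (phi : {multiplicative G -> G}).
Variable A : set G.
Hypothesis A_inv : invariant_subgroup phi A.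
Hypothesis A_abel : forall x y, A x -> A y -> commute x y.

(** Write T_n for T_n(phi, K). As T_(n+2) = K phi(T_(n+1)) with K contained in
T_(n+1), every coset of T_(n+1) in T_(n+2) is met by phi(T_(n+1)); so phi maps
the cosets of T_n in T_(n+1) onto those of T_(n+1) in T_(n+2). The successive
indices therefore decrease, until they are constant. *)
Lemma entropy_at_submonoid K : submonoid K -> ([set` K] `<=` A)%classic ->
  exists2 alpha : nat, (0 < alpha)%N & entropy_at R phi K = (ln alpha%:R)%:E.
Proof.
move=> [K1 KK] KA; have [A1 AM AV Aphi] := A_inv.
pose T := trajectory phi K.
have Tm n : submonoid (T n).
  split; first exact: trajectory_mem1.
  rewrite -trajectory_mulg ?KK // => i j x y /KA Ax /KA Ay.
  by apply: A_abel; exact: iter_closed.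
have TS n : T n `<=` T n.+1.
  rewrite /T /= -{1}(fset_mulg1 (trajectory phi K n)); apply: fset_mulg_subset => //.
  by rewrite fsub1set; apply/imfsetP; exists 1; rewrite ?iter_hom1.
have TphiE n : T n.+1 = fset_mulg K [fset phi x | x in T n].
  by rewrite /T -add1n trajectory_add trajectory1.
have phiT n : [fset phi x | x in T n] `<=` T n.+1.
  rewrite TphiE -{1}(fset_mul1g [fset phi x | x in T n]).
  by apply: fset_mulg_subset; rewrite // fsub1set.
have TA n x : x \in T n -> A x by apply: trajectory_in => //; exact: KA.
pose d n := #|` cosets (T n.+1) (T n)|.
have dS n : (d n.+1 <= d n)%N.
  (* The map induced by phi on cosets: g (x T_n) = phi(x) T_(n+1). *)
  pose g (D : {fset G}) := fset_mulg [fset phi x | x in D] (T n.+1).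
  have gE x : g (coset x (T n)) = coset (phi x) (T n.+1).
    rewrite /g imfset_mulg; last exact: gmulfM.
    rewrite -fset_mulgA (submonoid_absorb (Tm n.+1)) ?phiT //; last first.
      by apply/imfsetP; exists 1; rewrite ?hom1 //; case: (Tm n).
    congr fset_mulg; apply/fsetP => y; rewrite inE.
    apply/imfsetP/eqP => /= [[z /fset1P -> ->]//|->].
    by exists x; rewrite ?inE.
  apply: (@leq_trans #|` [fset g D | D in cosets (T n.+1) (T n)]|); last first.
    exact: leq_imfset_card.
  apply: fsubset_leq_card; apply/fsubsetP => _ /imfsetP[y /= + ->].
  rewrite TphiE => /fset_mulgP[k [_ [kK /imfsetP[x /= xT ->] ->]]].
  apply/imfsetP; exists (coset x (T n)); first by apply/imfsetP; exists x.
  rewrite gE A_abel; [|exact: KA|by apply: Aphi; exact: TA xT].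
  by rewrite cosetM (coset_absorb (Tm _) (fsubsetP (sub_trajectory _ K1 _) _ kK)).
have [k dk] := nonincreasing_stationary dS.
have cardT n : #|` T (k + n)%N| = (#|` T k| * d k ^ n)%N.
  elim: n => [|n IH]; first by rewrite addn0 expn0 muln1.
  rewrite addnS (lagrange (Tm (k + n)%N) (Tm _) (TS _)) -/(d _) dk IH expnS.
  by rewrite mulnCA.
have K0 : K != fset0 by apply/fset0Pn; exists 1.
have d0 : (0 < d k)%N.
  rewrite lt0n; apply/eqP => dk0; have := cardT 1%N.
  rewrite dk0 muln0 => /cardfs0_eq/eqP; apply/negP; exact: trajectory_neq0.
exists (d k) => //; have [c -> cr] := entropy_atP R phi K0.
congr (_%:E); apply: (rate_affine cr (k := k) (C := ln #|` T k|%:R)) => n.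
rewrite /growth -/(T _) cardT natrM lnM ?posrE ?card_trajectory_gt0 //.
  by rewrite natrX lnXn ?ltr0n // mulr_natl.
by rewrite ltr0n expn_gt0 d0.
Qed.

Hypothesis A_tors : forall x, A x -> exists2 m : nat, (0 < m)%N & x ^+ m = 1.

(** Add the elements of F one at a time: if K is a finite submonoid and x has
finite order, then K times the powers of x is again one. *)
Lemma submonoid_cover F : ([set` F] `<=` A)%classic ->
  exists K, [/\ submonoid K, F `<=` K & ([set` K] `<=` A)%classic].
Proof.
have [A1 AM AV Aphi] := A_inv.
suff cover (s : seq G) : (forall x, x \in s -> A x) ->
    exists K, [/\ submonoid K, forall x, x \in s -> x \in K & ([set` K] `<=` A)%classic].
  move=> FA; have [K [Km FK KA]] := cover (enum_fset F) FA.
  by exists K; split => //; apply/fsubsetP.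
elim: s => [_|x s IH sA].
  exists [fset 1]; split => //; last by move=> x /= /fset1P ->.
  by split; rewrite ?inE // fset_mul1g.
have [y ys|K [[K1 KK] sK KA]] := IH; first by apply: sA; rewrite inE ys orbT.
have Ax : A x by apply: sA; rewrite inE eqxx.
have [m m0 xm] := A_tors Ax.
have xmod i : x ^+ (i %% m) = x ^+ i.
  by rewrite {2}(divn_eq i m) expgnDr mulnC expgnA xm expg1n mul1g.
pose P := [fset x ^+ i | i in iota 0 m].
have memP i : x ^+ i \in P.
  by rewrite -xmod in_imfset //= mem_iota add0n ltn_mod.
have PP y : y \in P -> exists i, y = x ^+ i by move=> /imfsetP[i _ ->]; exists i.
have AX i : A (x ^+ i) by elim: i => // i IHi; rewrite expgS; exact: AM.
have P1 : 1 \in P by rewrite -(expg0 x).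
exists (fset_mulg K P); split.
- split; first by rewrite -[1]mulg1 mem_fset_mulg.
  rewrite -fset_mulgA [X in fset_mulg K X]fset_mulgA [fset_mulg P K]fset_mulg_commute.
    rewrite -fset_mulgA fset_mulgA KK; congr fset_mulg.
    apply/fsetP => z; apply/fset_mulgP/idP => [[_ [_ [/PP[i ->] /PP[j ->] ->]]]|zP].
      by rewrite -expgnDr.
    by exists 1, z; rewrite mul1g.
  by move=> _ z /PP[i ->] zK; apply: A_abel; [exact: AX | exact: KA].
- move=> y; rewrite inE => /orP[/eqP->|/sK yK].
    by rewrite -[x]mul1g mem_fset_mulg // -[x]expg1.
  by rewrite -[y]mulg1 mem_fset_mulg.
by move=> _ /= /fset_mulgP[y [_ [/KA Ay /PP[i ->] ->]]]; exact: AM.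
Qed.

Lemma log_nat_entropy_on : log_nat (entropy_on R phi A).
Proof.
have [A1 _ _ _] := A_inv.
pose S := [set entropy_at R phi K |
  K in [set K | submonoid K /\ ([set` K] `<=` A)%classic]].
suff -> : entropy_on R phi A = ereal_sup S.
  apply: (@log_nat_sup _ _ (entropy_at R phi [fset 1])).
    exists [fset 1] => //; split; last by move=> x /= /fset1P ->.
    by split; rewrite ?inE // fset_mul1g.
  by move=> _ [K [Km KA] <-]; right; exact: entropy_at_submonoid.
apply/le_anti/andP; split.
  apply: entropy_on_le => F F0 FA; have [K [Km FK KA]] := submonoid_cover FA.
  apply: le_trans (entropy_at_subset R phi F0 FK) _.
  by apply: ereal_sup_ubound; exists K.
apply: ge_ereal_sup => _ [K [[K1 _] KA] <-]; apply: entropy_at_le_on => //.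
by apply/fset0Pn; exists 1.
Qed.

End TorsionAbelian.

(** * Entropy of sections *)

Local Close Scope fset_scope.
Local Open Scope classical_set_scope.

Section Injective.
Variables (R : realType) (G H : groupType).
Variables (phi : {multiplicative G -> G}) (psi : {multiplicative H -> H}).

Lemma entropy_on_set1 : entropy_on R phi [set 1] = 0%E.
Proof.
apply/le_anti/andP; split; last exact: (@entropy_on_ge0 _ _ _ _ 1).
apply: entropy_on_le => F F0 F1.
have [c -> cr] := entropy_atP R phi F0.
have T1 n x : x \in trajectory phi F n -> x = 1.
  apply: (@trajectory_in _ phi [set 1]) => //.
  - by move=> y z /= -> ->; rewrite mulg1.
  - by move=> y /= ->; rewrite hom1.
suff -> : c = 0%R by [].
apply: (rate_affine cr (k := 0) (C := 0%R)) => n.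
rewrite /growth add0n mulr0 addr0.
have -> : trajectory phi F n = [fset 1]%fset; last by rewrite cardfs1 ln1.
have /fset0Pn[y yT] := trajectory_neq0 phi n F0.
apply/fsetP => x; rewrite inE; apply/idP/eqP => [/T1//|->].
by rewrite -(T1 n y yT).
Qed.

(** This is the case of [entropy_on_central] in which the central part is
trivial. *)
Lemma entropy_on_injective (r : {multiplicative G -> H}) A :
  (forall x, r (phi x) = psi (r x)) -> invariant_subgroup phi A ->
  (forall x, A x -> r x = 1 -> x = 1) ->
  entropy_on R phi A = entropy_on R psi (r @` A).
Proof.
move=> rphi Ainv r_inj; rewrite (entropy_on_central R rphi Ainv); last first.
  by move=> x y Ax /(r_inj x Ax) -> _; exact/commute_sym/commute1.
rewrite (_ : A `&` _ = [set 1]) ?entropy_on_set1 ?add0e //.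
have [A1 _ _ _] := Ainv; apply/seteqP; split => x /=; first by case=> Ax /r_inj ->.
by move=> ->; rewrite hom1.
Qed.

End Injective.

Section NormalProduct.
Variables (G : groupType) (M N : normalClosed G).

Definition normal_product : {pred G} :=
  [pred x | `[< exists y z, [/\ y \in M, z \in N & x = y * z] >]].

Lemma normal_productP x :
  reflect (exists y z, [/\ y \in M, z \in N & x = y * z]) (x \in normal_product).
Proof. by rewrite inE; exact: asboolP. Qed.

Lemma normal_productM : mulg_closed normal_product.
Proof.
move=> _ _ /normal_productP[y [z [yM zN ->]]] /normal_productP[t [w [tM wN ->]]].
apply/normal_productP; exists (y * t ^ z^-1), (z * w); split.
- by rewrite gpredM ?gpred_conj.
- by rewrite gpredM.
- by rewrite conjgE invgK !mulgA mulgVK.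
Qed.

Lemma normal_product1 : 1 \in normal_product.
Proof. by apply/normal_productP; exists 1, 1; rewrite !gpred1 mulg1. Qed.

Lemma normal_productV : invg_closed normal_product.
Proof.
move=> _ /normal_productP[y [z [yM zN ->]]]; apply/normal_productP.
exists (y^-1 ^ z), z^-1; rewrite ?gpred_conj ?gpredV //; split => //.
by rewrite invgM conjgE -!mulgA mulgV mulg1.
Qed.

Lemma normal_product_conj x y : x \in normal_product -> x ^ y \in normal_product.
Proof.
move=> /normal_productP[t [z [tM zN ->]]]; apply/normal_productP.
by exists (t ^ y), (z ^ y); rewrite !gpred_conj // conjMg.
Qed.

HB.instance Definition _ := isMulClosed.Build G normal_product normal_productM.
HB.instance Definition _ := isMul1Closed.Build G normal_product normal_product1.
HB.instance Definition _ := isInvClosed.Build G normal_product normal_productV.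
HB.instance Definition _ := isConjClosed.Build G normal_product normal_product_conj.

Definition normal_prod : normalClosed G := NormalClosed.clone G normal_product _.

End NormalProduct.

Section QuotientLift.
Variables (G : groupType) (M N : normalClosed G).

Lemma quotient_proj_eq1 x : (quotient_proj N x = 1) <-> x \in N.
Proof.
rewrite -[1]/(quotient_proj N 1); split=> [/quotient_projP|xN].
  by rewrite mulg1 gpredV.
by apply/quotient_projP; rewrite mulg1 gpredV.
Qed.

(** The projection from G/M to G/N, for M contained in N. *)
Definition quotient_lift of {subset M <= N} :=
  fun q : quotient_group M => quotient_proj N (repr q).

Hypothesis MN : {subset M <= N}.

Lemma quotient_lift_proj x : quotient_lift MN (quotient_proj M x) = quotient_proj N x.
Proof. exact/quotient_projP/MN/mem_repr_proj. Qed.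

Lemma quotient_liftM : {morph quotient_lift MN : a b / a * b}.
Proof.
move=> a b; rewrite -[a]quotient_reprK -[b]quotient_reprK -quotient_projMg.
by rewrite !quotient_lift_proj quotient_projMg.
Qed.

HB.instance Definition _ := isMultiplicative.Build
  (quotient_group M) (quotient_group N) (quotient_lift MN) quotient_liftM.

End QuotientLift.

Section Sections.
Variables (R : realType) (G : groupType) (phi : {multiplicative G -> G}).
Implicit Types (B D : normalClosed G) (A : set G).

(** The entropy of the section AB/B; A need not contain B, so that AB never has to
be formed. *)
Definition section_entropy B (phiB : phi @` [set` B] = [set` B]) A :=
  entropy_on R (quotient_map phiB) (quotient_proj B @` A).

Lemma invariant_subgroup_proj B (phiB : phi @` [set` B] = [set` B]) A :
  invariant_subgroup phi A ->
  invariant_subgroup (quotient_map phiB) (quotient_proj B @` A).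
Proof.
move=> [A1 AM AV Aphi]; split.
- by exists 1.
- move=> _ _ [x Ax <-] [y Ay <-]; rewrite -quotient_projMg.
  by exists (x * y) => //; exact: AM.
- by move=> _ [x Ax <-]; rewrite -quotient_projVg; exists x^-1 => //; exact: AV.
- by move=> _ [x Ax <-]; rewrite quotient_map_proj; exists (phi x) => //; exact: Aphi.
Qed.

Lemma quotient_lift_map B D (BD : {subset B <= D})
    (phiB : phi @` [set` B] = [set` B]) (phiD : phi @` [set` D] = [set` D]) q :
  quotient_lift BD (quotient_map phiB q) = quotient_map phiD (quotient_lift BD q).
Proof.
rewrite -[q]quotient_reprK.
by rewrite quotient_map_proj !quotient_lift_proj quotient_map_proj.
Qed.

Lemma image_quotient_lift B D (BD : {subset B <= D}) A :
  quotient_lift BD @` (quotient_proj B @` A) = quotient_proj D @` A.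
Proof.
rewrite image_comp; apply: eq_imagel => x _ /=.
exact: quotient_lift_proj.
Qed.

(** Apply [entropy_on_central] to the projection from G/B to G/D, whose kernel
meets AB/B in (A cap D)B/B. *)
Lemma section_entropyD B D (BD : {subset B <= D})
    (phiB : phi @` [set` B] = [set` B]) (phiD : phi @` [set` D] = [set` D]) A :
  invariant_subgroup phi A ->
  (forall x y, A x -> x \in D -> A y ->
     commute (quotient_proj B x) (quotient_proj B y)) ->
  section_entropy phiB A =
    (section_entropy phiB (A `&` [set` D]) + section_entropy phiD A)%E.
Proof.
move=> Ainv Acen; rewrite /section_entropy.
rewrite (entropy_on_central R (quotient_lift_map BD phiB phiD)
  (invariant_subgroup_proj phiB Ainv)); last first.
  move=> _ _ [x Ax <-] + [y Ay <-].
  by rewrite /= quotient_lift_proj => /quotient_proj_eq1 xD; exact: Acen.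
rewrite image_quotient_lift; congr (entropy_on _ _ _ + _)%E.
apply/seteqP; split => [_ [[x Ax <-] /=]|_ [x [Ax xD] <-]].
  by rewrite quotient_lift_proj => /quotient_proj_eq1 xD; exists x.
by split; [exists x | rewrite /= quotient_lift_proj; exact/quotient_proj_eq1].
Qed.

Lemma section_entropy0 B (phiB : phi @` [set` B] = [set` B]) A :
  A 1 -> A `<=` [set` B] -> section_entropy phiB A = 0%E.
Proof.
move=> A1 AB; rewrite /section_entropy (_ : _ @` _ = [set 1]) ?entropy_on_set1 //.
apply/seteqP; split => [_ [x /AB xB <-]|_ ->]; first exact/quotient_proj_eq1.
by exists 1.
Qed.

Lemma section_entropy_ge0 B (phiB : phi @` [set` B] = [set` B]) A :
  A 1 -> (0 <= section_entropy phiB A)%E.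
Proof. by move=> A1; apply: (@entropy_on_ge0 _ _ _ _ 1); exists 1. Qed.

Section Chain.
Variables (B : nat -> normalClosed G).
Hypothesis phiB : forall j, phi @` [set` B j] = [set` B j].
Hypothesis BS : forall j, {subset B j <= B j.+1}.

Lemma section_entropy_chain A n : invariant_subgroup phi A ->
  (forall j x y, A x -> x \in B j.+1 -> A y ->
     commute (quotient_proj (B j) x) (quotient_proj (B j) y)) ->
  section_entropy (phiB 0) A =
  (\sum_(0 <= j < n) section_entropy (phiB j) (A `&` [set` B j.+1])
   + section_entropy (phiB n) A)%E.
Proof.
move=> Ainv Acen; elim: n => [|n IH]; first by rewrite big_nil add0e.
rewrite big_nat_recr //= -addeA IH; congr (_ + _)%E.
by rewrite (section_entropyD (@BS n) (phiB n) (phiB n.+1)) //; exact: Acen.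
Qed.

Lemma nneseries_sup (u : nat -> \bar R) : (forall j, 0 <= u j)%E ->
  (\sum_(0 <= j <oo) u j)%E = ereal_sup (range (fun n => \sum_(0 <= j < n) u j)%E).
Proof.
move=> u0; apply/cvg_lim => //; apply: ereal_nondecreasing_cvgn.
by apply: ereal_nondecreasing_series => *; exact: u0.
Qed.

(** Exhaust the group by subgroups A_n contained in B_n: the chain formula for A_n
is then a finite sum without remainder. The last hypothesis makes its j-th term
independent of n > j, hence equal to the entropy of A_(j+1) modulo B_j. *)
Lemma section_entropy_series (A : nat -> set G) :
  (forall n, invariant_subgroup phi (A n)) ->
  (forall m n, (m <= n)%N -> A m `<=` A n) ->
  (forall n, A n `<=` [set` B n]) ->
  (forall n j x y, A n x -> x \in B j.+1 -> A n y ->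
     commute (quotient_proj (B j) x) (quotient_proj (B j) y)) ->
  (forall n j x, (j < n)%N -> A n x -> x \in B j.+1 ->
     exists2 y, A j.+1 y & quotient_proj (B j) x = quotient_proj (B j) y) ->
  section_entropy (phiB 0) (\bigcup_n A n) =
  (\sum_(0 <= j <oo) section_entropy (phiB j) (A j.+1))%E.
Proof.
move=> Ainv Amono AB Acen Arep.
have A1 n : A n 1 by case: (Ainv n).
rewrite nneseries_sup; last by move=> j; exact: section_entropy_ge0.
rewrite /section_entropy image_bigcup entropy_on_bigcup; last first.
  by move=> m n mn; apply: image_subset; exact: Amono.
congr ereal_sup; apply: eq_imagel => n _.
rewrite -/(section_entropy (phiB 0) (A n)) (section_entropy_chain n) //; last exact: Acen.
rewrite section_entropy0 ?adde0 //.
apply: eq_big_nat => j /andP[_ jn]; congr (entropy_on _ _ _).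
apply/seteqP; split => [_ [x [Ax xB] <-]|_ [x Ax <-]].
  by have [y Ay ->] := Arep n j x jn Ax xB; exists y.
by exists x => //; split; [exact: Amono Ax | exact: AB].
Qed.

End Chain.
End Sections.

(** * The upper central series *)

Section UpperCentralSeries.
Variables (G : groupType) (phi : {multiplicative G -> G}).
Local Notation Z := (upper_central G).

Lemma upper_centralP n x :
  reflect (forall y, commute (quotient_proj (Z n) x) (quotient_proj (Z n) y))
          (x \in Z n.+1).
Proof. exact: center_preimP. Qed.

Lemma upper_central_subset n : {subset Z n <= Z n.+1}.
Proof.
move=> x xZ; apply/upper_centralP => y.
have -> : quotient_proj (Z n) x = 1 by exact/quotient_proj_eq1.
exact/commute_sym/commute1.
Qed.

Lemma upper_central_mono m n : (m <= n)%N -> {subset Z m <= Z n}.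
Proof.
move=> /subnK <-; elim: (n - m)%N => // k IH x /IH.
exact: upper_central_subset.
Qed.

Hypothesis phi_bij : bijective phi.

(** Membership of x in Z_(n+1) says that all commutators of x lie in Z_n, and phi
is a bijection compatible with commutators. *)
Lemma upper_central_phi n x : (phi x \in Z n) = (x \in Z n).
Proof.
have [phi' phiK phi'K] := phi_bij.
have comm k z y : commute (quotient_proj (Z k) z) (quotient_proj (Z k) y) <->
    (z * y)^-1 * (y * z) \in Z k.
  rewrite /commute -!quotient_projMg; split=> [/quotient_projP//|].
  by move=> ?; apply/quotient_projP.
elim: n x => [|n IH] x.
  rewrite !inE; apply/eqP/eqP => [phix1|->]; last exact: hom1.
  by apply: (can_inj phiK); rewrite hom1.
have phiE y : phi ((x * y)^-1 * (y * x)) = (phi x * phi y)^-1 * (phi y * phi x).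
  by rewrite gmulfM homV !gmulfM.
apply/upper_centralP/upper_centralP => xZ y; apply/comm.
  by rewrite -IH phiE; exact/comm.
by rewrite -(phi'K y) -phiE IH; exact/comm.
Qed.

Lemma upper_central_image n : phi @` [set` Z n] = [set` Z n].
Proof.
have [phi' phiK phi'K] := phi_bij; apply/seteqP; split => [_ [x xZ <-]|x xZ] /=.
  by rewrite upper_central_phi.
by exists (phi' x); rewrite //= -upper_central_phi phi'K.
Qed.

Lemma invariant_subgroup_closed (B : normalClosed G) :
  phi @` [set` B] = [set` B] -> invariant_subgroup phi [set` B].
Proof.
move=> phiB; split => /=; first exact: gpred1.
- by move=> x y; exact: gpredM.
- by move=> x; rewrite gpredV.
- by move=> x; exact: invariant_mem.
Qed.

Lemma invariant_subgroupI A A' : invariant_subgroup phi A ->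
  invariant_subgroup phi A' -> invariant_subgroup phi (A `&` A').
Proof.
move=> [A1 AM AV Aphi] [A1' AM' AV' Aphi']; split.
- by [].
- by move=> x y [Ax Ax'] [Ay Ay']; split; [exact: AM | exact: AM'].
- by move=> x [Ax Ax']; split; [exact: AV | exact: AV'].
- by move=> x [Ax Ax']; split; [exact: Aphi | exact: Aphi'].
Qed.

Variable H : normalClosed G.
Hypothesis phiH : phi @` [set` H] = [set` H].

Lemma normal_prod_image n :
  phi @` [set` normal_prod H (Z n)] = [set` normal_prod H (Z n)].
Proof.
have Zi := upper_central_image n.
apply/seteqP; split => [_ [x /= /normal_productP[h [z [hH zZ ->]]] <-]|x].
  apply/normal_productP; exists (phi h), (phi z).
  by rewrite gmulfM (invariant_mem phiH) // (invariant_mem Zi).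
move=> /normal_productP[h [z [hH zZ ->]]].
have : [set` H] h by []. rewrite -phiH => -[h' h'H <-].
have : [set` Z n] z by []. rewrite -Zi => -[z' z'Z <-].
rewrite -gmulfM; exists (h' * z') => //=.
by apply/normal_productP; exists h', z'.
Qed.

Lemma normal_prod_subset n : {subset normal_prod H (Z n) <= normal_prod H (Z n.+1)}.
Proof.
move=> x /normal_productP[h [z [hH zZ ->]]]; apply/normal_productP.
by exists h, z; rewrite (upper_central_subset zZ).
Qed.

Lemma sub_normal_prodl n : {subset H <= normal_prod H (Z n)}.
Proof. by move=> x xH; apply/normal_productP; exists x, 1; rewrite gpred1 mulg1. Qed.

Lemma sub_normal_prodr n : {subset Z n <= normal_prod H (Z n)}.
Proof. by move=> x xZ; apply/normal_productP; exists 1, x; rewrite gpred1 mul1g. Qed.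

Lemma quotient_proj_normal_prod n h z : h \in H ->
  quotient_proj (normal_prod H (Z n)) (h * z) = quotient_proj (normal_prod H (Z n)) z.
Proof.
move=> hH; rewrite quotient_projMg (_ : quotient_proj _ h = 1) ?mul1g //.
exact/quotient_proj_eq1/sub_normal_prodl.
Qed.

Lemma normal_prod_central n x y : x \in normal_prod H (Z n.+1) ->
  commute (quotient_proj (normal_prod H (Z n)) x)
          (quotient_proj (normal_prod H (Z n)) y).
Proof.
move=> /normal_productP[h [z [hH zZ ->]]]; rewrite quotient_proj_normal_prod //.
rewrite -!(quotient_lift_proj (@sub_normal_prodr n)) /commute -!quotient_liftM.
by move/upper_centralP: zZ => ->.
Qed.

End UpperCentralSeries.

(** * The addition theorem *)

Section AdditionTheorem.
Variables (R : realType) (G : groupType) (phi : {multiplicative G -> G}).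
Hypothesis hyperG : omega_hypercentral G.
Hypothesis phi_bij : bijective phi.
Local Notation Z := (upper_central G).
Let phiZ n := upper_central_image phi_bij n.

Let Zinv n : invariant_subgroup phi [set` Z n].
Proof. exact: invariant_subgroup_closed. Qed.

Let entropy_on_section A : invariant_subgroup phi A ->
  entropy_on R phi A = section_entropy R (phiZ 0) A.
Proof.
move=> Ainv; apply: entropy_on_injective => // [x|x _].
  by rewrite /= quotient_map_proj.
by move=> /quotient_proj_eq1; rewrite inE => /eqP.
Qed.

Let setT_inv : invariant_subgroup phi setT. Proof. by []. Qed.

Lemma entropy_series : entropy R phi =
  (\sum_(0 <= j <oo) section_entropy R (phiZ j) [set` Z j.+1])%E.
Proof.
rewrite -entropy_onT entropy_on_section // hyperG.
apply: (section_entropy_series R phiZ (@upper_central_subset G)) => //.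
- by move=> m n mn x; exact: (upper_central_mono mn).
- by move=> n x.
- by move=> n j x y _ /upper_centralP xZ _; exact: xZ.
- by move=> n j x _ _ xZ; exists x.
Qed.

Section Subgroup.
Variables (H : normalClosed G) (phiH : phi @` [set` H] = [set` H]).
Let phiHZ n := normal_prod_image phi_bij phiH n.

Let Hinv : invariant_subgroup phi [set` H].
Proof. exact: invariant_subgroup_closed. Qed.

Lemma entropy_restriction_series : entropy R (restriction phiH) =
  (\sum_(0 <= j <oo) section_entropy R (phiZ j) ([set` H] `&` [set` Z j.+1]))%E.
Proof.
rewrite -entropy_onT.
rewrite (@entropy_on_injective R _ _ _ phi (val : {multiplicative subgroup_of H -> G})) //.
  rewrite (_ : _ @` _ = [set` H]); last first.
    apply/seteqP; split => [_ [x _ <-]|x xH]; first exact: (valP x).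
    by exists (exist _ x xH).
  rewrite entropy_on_section // -[X in section_entropy _ _ X]setIT hyperG setI_bigcupr.
  apply: (section_entropy_series R phiZ (@upper_central_subset G)).
  - by move=> n; exact: invariant_subgroupI.
  - by move=> m n mn x [xH xZ]; split => //; exact: (upper_central_mono mn).
  - by move=> n x [].
  - by move=> n j x y _ /upper_centralP xZ _; exact: xZ.
  - by move=> n j x _ [xH _] xZ; exists x.
by move=> x _ x1; apply: val_inj.
Qed.

(** The chain H Z_j starts at H Z_0, which is H. Its factors are described by the
subgroups Z_(j+1) of G, because the elements of H are trivial modulo H Z_j. *)
Lemma entropy_quotient_series : entropy R (quotient_map phiH) =
  (\sum_(0 <= j <oo) section_entropy R (phiHZ j) [set` Z j.+1])%E.
Proof.
rewrite -entropy_onT.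
have qT : quotient_proj H @` setT = setT.
  by apply/seteqP; split => // q _; exists (repr q) => //; exact: quotient_reprK.
rewrite -qT (@entropy_on_injective R _ _ _ (quotient_map (phiHZ 0))
   (quotient_lift (@sub_normal_prodl G H 0))).
- rewrite image_quotient_lift -/(section_entropy R (phiHZ 0) setT) hyperG.
  apply: (section_entropy_series R phiHZ (@normal_prod_subset G H)) => //.
  + by move=> m n mn x; exact: (upper_central_mono mn).
  + by move=> n x; exact: sub_normal_prodr.
  + by move=> n j x y _ xHZ _; exact: normal_prod_central.
  + move=> n j x jn _ /normal_productP[h [z [hH zZ ->]]]; exists z => //.
    exact: quotient_proj_normal_prod.
- exact: quotient_lift_map.
- exact: invariant_subgroup_proj.
- move=> _ [x _ <-]; rewrite /= quotient_lift_proj => /quotient_proj_eq1.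
  move=> /normal_productP[h [z [hH /= /[!inE]/eqP -> ->]]].
  by rewrite mulg1; exact/quotient_proj_eq1.
Qed.

(** Termwise, this is [section_entropyD] for Z_(j+1) modulo Z_j and H Z_j; by the
modular law, the intersection of Z_(j+1) with H Z_j and that with H have the
same image modulo Z_j. *)
Lemma entropy_addition : entropy R phi =
  (entropy R (restriction phiH) + entropy R (quotient_map phiH))%E.
Proof.
rewrite entropy_series entropy_restriction_series entropy_quotient_series.
rewrite -nneseriesD; last 2 first.
- by move=> j _ _; apply: section_entropy_ge0; split; exact: gpred1.
- by move=> j _ _; apply: section_entropy_ge0; exact: gpred1.
congr (limn _); apply/funext => n; apply: eq_big_nat => j _.
rewrite (section_entropyD R (@sub_normal_prodr G H j) (phiZ j) (phiHZ j)) //; last first.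
  by move=> x y /upper_centralP xZ _ _; exact: xZ.
congr (entropy_on _ _ _ + _)%E; apply/seteqP; split => [_ [x [/= xZ xHZ] <-]|].
  case/normal_productP: xHZ xZ => h [z [hH zZ ->]] hzZ.
  exists h; first split => //=.
    by rewrite -(mulgK z h) gpredM ?gpredV // (upper_central_subset zZ).
  apply/quotient_projP; rewrite mulKg //.
move=> _ [x [/= xH xZ] <-]; exists x => //; split => //.
exact: sub_normal_prodl.
Qed.

End Subgroup.

Lemma log_nat_entropy_torsion : torsion_group G -> log_nat (entropy R phi).
Proof.
move=> torG; rewrite entropy_series nneseries_sup; last first.
  by move=> j; apply: section_entropy_ge0; exact: gpred1.
apply: (@log_nat_sup _ _ 0%E); first by exists 0%N; rewrite // big_nil.
move=> _ [n _ <-]; apply: (big_ind (@log_nat R)); first exact: log_nat0.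
  exact: log_natD.
move=> j _; apply: log_nat_entropy_on.
- exact: invariant_subgroup_proj.
- by move=> _ _ [x /upper_centralP xZ <-] [y _ <-]; exact: xZ.
move=> _ [x _ <-]; have [m m0 xm] := torG x; exists m => //.
by rewrite -homX xm hom1.
Qed.

End AdditionTheorem.

Theorem proposition5p5 (R : realType) (G : groupType)
    (phi : {multiplicative G -> G}) :
  omega_hypercentral G -> bijective phi ->
  (forall (H : normalClosed G) (phiH : phi @` [set` H] = [set` H]),
     entropy R phi =
       (entropy R (restriction phiH) + entropy R (quotient_map phiH))%E) /\
  (torsion_group G ->
     entropy R phi = +oo%E \/
     exists2 alpha : nat, (0 < alpha)%N & entropy R phi = (ln alpha%:R)%:E).
Proof.
move=> hyperG phi_bij; split; first by move=> H phiH; exact: entropy_addition.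
exact: log_nat_entropy_torsion.
Qed.
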